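(* Let $p\ge 2$ and $q=e^{\pi i/p}$. The basic algebras $B_0=e_p^{-}\mathcal{Q}_0e_p^{-}$ and $B_p=e_p^{+}\mathcal{Q}_pe_p^{+}$ are both $1$-dimensional commutative algebras.
   Context: $\overline{U}_q=\overline{U}_qsl_2(\mathbb{C})$ is the associative unital $\mathbb{C}$-algebra generated by $E,F,K$ with relations $E^p=F^p=0$, $K^{2p}=1$, $KEK^{-1}=q^2E$, $KFK^{-1}=q^{-2}F$, $EF-FE=\frac{K-K^{-1}}{q-q^{-1}}$. Put $[n]=\frac{q^n-q^{-n}}{q-q^{-1}}$. Put $v_p^{\pm}=\sum_{\ell=0}^{2p-1}(\pm q^{-(p-1)})^{\ell}K^{\ell}$, $a_0^{\pm}(p)=E^{p-1}F^{p-1}v_p^{\pm}$ and $e_p^{\pm}=\frac{1}{2p\prod_{i=1}^{p-1}(\pm[i][p-i])}a_0^{\pm}(p)$ (upper signs together, lower signs together); these are primitive idempotents of $\overline{U}_q$. The Casimir element $C=EF+\frac{q^{-1}K+qK^{-1}}{(q-q^{-1})^2}$ is central, with minimal polynomial $(x-\beta_0)(x-\beta_p)\prod_{j=1}^{p-1}(x-\beta_j)^2$, $\beta_j=\frac{q^j+q^{-j}}{(q-q^{-1})^2}$. Accordingly $\overline{U}_q=\bigoplus_{s=0}^{p}\mathcal{Q}_s$, where $\mathcal{Q}_s$ is the subalgebra (two-sided ideal) of $\overline{U}_q$ on which $C$ has the (generalized) eigenvalue $\beta_s$. One has $e_p^{-}\in\mathcal{Q}_0$ and $e_p^{+}\in\mathcal{Q}_p$.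 *)

(* Defs.v *)
(* Complex numbers are R[i] for R : realType. The notations of monalg clash with
   those of MathComp-Analysis, hence the qualified names. *)
From HB Require Import structures.
From mathcomp Require Import all_boot all_algebra.
From mathcomp Require Import all_classical all_reals all_analysis.
From mathcomp Require Import complex.
From mathcomp Require finmap.
From mathcomp Require Import -(notations) monalg.

Set Implicit Arguments.
Unset Strict Implicit.
Unset Printing Implicit Defensive.

Import GRing.Theory.
Local Open Scope ring_scope.
Local Open Scope quotient_scope.
Local Open Scope classical_set_scope.

Section FreeAlgebra.
Variables (k : fieldType) (X : choiceType).

(* The free algebra k<X> is the monoid algebra of the free monoid on X; the
   alias carries the algebra structure, which monalg declares only for
   commutative monoids. *)
Definition free_algebra := monalg.malg (monalg.fmonom X) k.

HB.instance Definition _ := GRing.Lalgebra.on free_algebra.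

Lemma free_scalerAr (c : k) (x y : free_algebra) :
  c *: (x * y) = x * (c *: y).
Proof.
rewrite [x * y]monalg.malgME.
rewrite [x * (c *: y)](monalg.malgMEw (finmap.fsubset_refl _) (monalg.msuppZ_le c y)).
rewrite scaler_sumr; apply: eq_bigr => i _.
rewrite scaler_sumr; apply: eq_bigr => j _.
apply/monalg.malgP => m.
rewrite monalg.mcoeffZ !monalg.mcoeffU monalg.mcoeffZ.
by rewrite -mulrnAr -mulrnAr mulrCA !mulrnAr.
Qed.

HB.instance Definition _ := GRing.Lalgebra_isAlgebra.Build k free_algebra
  free_scalerAr.

Definition free_gen (x : X) : free_algebra := monalg.mkmalgU (monalg.fmu x) 1.

(* The universal property of k<X>. *)
Section Evaluation.
Variables (B : algType k) (g : X -> B).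

Definition word_eval (m : monalg.fmonom X) : B :=
  \prod_(x <- (m : seq X)) g x.

Lemma word_eval_mmorphism : monalg.mmorphism word_eval.
Proof.
split=> [m1 m2|]; last by rewrite /word_eval monalg.fm1 big_nil.
by rewrite /word_eval monalg.fmM big_cat.
Qed.

HB.instance Definition _ := monalg.isMultiplicative.Build
  (monalg.fmonom X) B word_eval word_eval_mmorphism.

Definition free_eval : free_algebra -> B :=
  monalg.mmap (in_alg B) word_eval.

Lemma free_eval_zmod_morphism : zmod_morphism free_eval.
Proof. exact: monalg.mmap_is_additive. Qed.

Lemma free_eval_monoid_morphism : monoid_morphism free_eval.
Proof.
have [|hM h1] := @monalg.commr_mmap_is_multiplicative
  (monalg.fmonom X) k B (in_alg B) word_eval.
  by move=> y m m'; rewrite /GRing.comm mulr_algl mulr_algr.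
by split; [exact: h1 | exact: hM].
Qed.

Lemma free_eval_scalable : scalable free_eval.
Proof.
by move=> c x; rewrite /free_eval monalg.mmapZ /= mulr_algl.
Qed.

HB.instance Definition _ := GRing.isZmodMorphism.Build free_algebra B free_eval
  free_eval_zmod_morphism.
HB.instance Definition _ := GRing.isMonoidMorphism.Build free_algebra B
  free_eval free_eval_monoid_morphism.
HB.instance Definition _ := GRing.isScalable.Build k free_algebra B *:%R
  free_eval free_eval_scalable.

Lemma free_eval_gen x : free_eval (free_gen x) = g x.
Proof.
rewrite /free_eval /free_gen monalg.mmapU /= scale1r mul1r.
by rewrite /word_eval monalg.fmU big_seq1.
Qed.

End Evaluation.

End FreeAlgebra.

Section PresentedAlgebra.
Variables (k : fieldType) (A : algType k) (rels : seq A).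

Inductive in_ideal : A -> Prop :=
| in_ideal0 : in_ideal 0
| in_idealD a r b x :
    r \in rels -> in_ideal x -> in_ideal (a * r * b + x).

Lemma in_ideal_add x y : in_ideal x -> in_ideal y -> in_ideal (x + y).
Proof.
elim=> [|a r b z rR _ IH] yI; first by rewrite add0r.
by rewrite -addrA; apply: in_idealD => //; apply: IH.
Qed.

Lemma in_ideal_mull c x : in_ideal x -> in_ideal (c * x).
Proof.
elim=> [|a r b z rR _ IH]; first by rewrite mulr0; apply: in_ideal0.
by rewrite mulrDr !mulrA; apply: in_idealD.
Qed.

Lemma in_ideal_mulr c x : in_ideal x -> in_ideal (x * c).
Proof.
elim=> [|a r b z rR _ IH]; first by rewrite mul0r; apply: in_ideal0.
by rewrite mulrDl -[_ * c]mulrA; apply: in_idealD.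
Qed.

Lemma in_ideal_scale (c : k) x : in_ideal x -> in_ideal (c *: x).
Proof. by move=> xI; rewrite -mulr_algl; apply: in_ideal_mull. Qed.

Definition ideal_pred : {pred A} := fun x => `[< in_ideal x >].

Lemma ideal_predP x : reflect (in_ideal x) (x \in ideal_pred).
Proof. exact: asboolP. Qed.

Lemma ideal_zmod_closed : zmod_closed ideal_pred.
Proof.
split=> [|x y /ideal_predP xI /ideal_predP yI]; apply/ideal_predP.
  exact: in_ideal0.
by rewrite -scaleN1r; apply: in_ideal_add => //; apply: in_ideal_scale.
Qed.

HB.instance Definition _ := GRing.isZmodClosed.Build A ideal_pred
  ideal_zmod_closed.

(* A / (rels); algType requires 1 != 0, hence the argument. *)
Definition presented_algebra (proper : ~ in_ideal 1) : Type :=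
  Quotient.quot ideal_pred.

Hypothesis proper : ~ in_ideal 1.
Local Notation Q := (presented_algebra proper).

HB.instance Definition _ := Choice.on Q.
HB.instance Definition _ := EqQuotient.on Q.
HB.instance Definition _ := GRing.Zmodule.on Q.

Definition pres_pi (x : A) : Q := \pi_(Quotient.quot ideal_pred) x.

Lemma pres_pi_eq x y : pres_pi x = pres_pi y <-> in_ideal (x - y).
Proof.
split=> [/eqmodP|h]; first by move/ideal_predP.
by apply/eqmodP; apply/ideal_predP.
Qed.

Lemma pres_repr (x : Q) : pres_pi (repr x) = x.
Proof. exact: reprK. Qed.

Lemma pres_piB : {morph pres_pi : x y / x - y}.
Proof. exact: raddfB (\pi_(Quotient.quot ideal_pred)). Qed.

Lemma pres_piD : {morph pres_pi : x y / x + y}.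
Proof. exact: raddfD (\pi_(Quotient.quot ideal_pred)). Qed.

Lemma repr_pres_pi x : in_ideal (repr (pres_pi x) - x).
Proof. by apply/pres_pi_eq; rewrite pres_repr. Qed.

Definition pres_one : Q := pres_pi 1.
Definition pres_mul (x y : Q) : Q := pres_pi (repr x * repr y).
Definition pres_scale (c : k) (x : Q) : Q := pres_pi (c *: repr x).

Lemma pres_piM' x y : pres_mul (pres_pi x) (pres_pi y) = pres_pi (x * y).
Proof.
apply/pres_pi_eq.
set x' := repr _; set y' := repr _.
have -> : x' * y' - x * y = x' * (y' - y) + (x' - x) * y.
  by rewrite mulrBr mulrBl addrA subrK.
by apply: in_ideal_add; [apply: in_ideal_mull|apply: in_ideal_mulr];
  apply: repr_pres_pi.
Qed.

Lemma pres_piZ' c x : pres_scale c (pres_pi x) = pres_pi (c *: x).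
Proof.
by apply/pres_pi_eq; rewrite -scalerBr; apply/in_ideal_scale/repr_pres_pi.
Qed.

Lemma pres_mulA : associative pres_mul.
Proof.
move=> x y z; rewrite -(pres_repr x) -(pres_repr y) -(pres_repr z).
by rewrite !pres_piM' mulrA.
Qed.

Lemma pres_mul1 : left_id pres_one pres_mul.
Proof. by move=> x; rewrite -(pres_repr x) pres_piM' mul1r. Qed.

Lemma pres_1mul : right_id pres_one pres_mul.
Proof. by move=> x; rewrite -(pres_repr x) pres_piM' mulr1. Qed.

Lemma pres_mulDl : left_distributive pres_mul +%R.
Proof.
move=> x y z; rewrite -(pres_repr x) -(pres_repr y) -(pres_repr z).
by rewrite -pres_piD !pres_piM' mulrDl pres_piD.
Qed.

Lemma pres_mulDr : right_distributive pres_mul +%R.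
Proof.
move=> x y z; rewrite -(pres_repr x) -(pres_repr y) -(pres_repr z).
by rewrite -pres_piD !pres_piM' mulrDr pres_piD.
Qed.

Lemma pres_1neq0 : pres_one != 0.
Proof.
apply/eqP => h; apply: proper; rewrite -[1]subr0; apply/pres_pi_eq.
by rewrite -/pres_one h -[X in pres_pi X](subrr 0) pres_piB subrr.
Qed.

HB.instance Definition _ := GRing.Zmodule_isNzRing.Build Q
  pres_mulA pres_mul1 pres_1mul pres_mulDl pres_mulDr pres_1neq0.

Lemma pres_scaleA a b x : pres_scale a (pres_scale b x) = pres_scale (a * b) x.
Proof. by rewrite -(pres_repr x) !pres_piZ' scalerA. Qed.

Lemma pres_scale1 : left_id 1 pres_scale.
Proof. by move=> x; rewrite -(pres_repr x) pres_piZ' scale1r. Qed.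

Lemma pres_scaleDr : right_distributive pres_scale +%R.
Proof.
move=> c x y; rewrite -(pres_repr x) -(pres_repr y).
by rewrite -pres_piD !pres_piZ' scalerDr pres_piD.
Qed.

Lemma pres_scaleDl x : {morph pres_scale^~ x : a b / a + b}.
Proof. by move=> a b; rewrite -(pres_repr x) !pres_piZ' scalerDl pres_piD. Qed.

HB.instance Definition _ := GRing.Zmodule_isLmodule.Build k Q
  pres_scaleA pres_scale1 pres_scaleDr pres_scaleDl.

Lemma pres_scaleAl (c : k) (x y : Q) : c *: (x * y) = (c *: x) * y.
Proof.
rewrite -(pres_repr x) -(pres_repr y).
rewrite [_ * _]pres_piM' [_ *: _]pres_piZ' [c *: pres_pi (repr x)]pres_piZ'.
by rewrite [RHS]pres_piM' scalerAl.
Qed.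

HB.instance Definition _ := GRing.Lmodule_isLalgebra.Build k Q pres_scaleAl.

Lemma pres_scaleAr (c : k) (x y : Q) : c *: (x * y) = x * (c *: y).
Proof.
rewrite -(pres_repr x) -(pres_repr y).
rewrite [_ * _]pres_piM' [_ *: _]pres_piZ' [c *: pres_pi (repr y)]pres_piZ'.
by rewrite [RHS]pres_piM' scalerAr.
Qed.

HB.instance Definition _ := GRing.Lalgebra_isAlgebra.Build k Q pres_scaleAr.

Lemma pres_pi_monoid_morphism : monoid_morphism pres_pi.
Proof. by split=> // x y; rewrite -pres_piM'. Qed.

Lemma pres_pi_scalable : scalable pres_pi.
Proof. by move=> c x; rewrite -pres_piZ'. Qed.

HB.instance Definition _ := GRing.isZmodMorphism.Build A Q pres_pi pres_piB.
HB.instance Definition _ := GRing.isMonoidMorphism.Build A Q pres_pi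
  pres_pi_monoid_morphism.
HB.instance Definition _ := GRing.isScalable.Build k A Q *:%R pres_pi
  pres_pi_scalable.

End PresentedAlgebra.

Section RestrictedQuantumGroup.
Variables (k : fieldType) (p : nat) (q : k).

Definition gen_E : free_algebra k 'I_3 := free_gen k (inord 0).
Definition gen_F : free_algebra k 'I_3 := free_gen k (inord 1).
Definition gen_K : free_algebra k 'I_3 := free_gen k (inord 2).

(* As K^(2p) = 1, the inverse of K is K^(2p-1). *)
Definition Uq_relations : seq (free_algebra k 'I_3) :=
  let E := gen_E in let F := gen_F in let K := gen_K in
  let Kinv := K ^+ (2 * p).-1 in
  [:: E ^+ p;
      F ^+ p;
      K ^+ (2 * p) - 1;
      K * E * Kinv - q ^+ 2 *: E;
      K * F * Kinv - q ^- 2 *: F;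
      E * F - F * E - (q - q^-1)^-1 *: (K - Kinv)].

(* The counit E, F |-> 0, K |-> 1 shows that the relations are consistent. *)
Lemma Uq_proper (p_gt1 : (1 < p)%N) : ~ in_ideal Uq_relations 1.
Proof.
pose g (i : 'I_3) : k^o := (i == inord 2)%:R.
pose f := free_eval g.
have fB x y : f (x - y) = f x - f y by exact: raddfB.
have fD x y : f (x + y) = f x + f y by exact: raddfD.
have fM x y : f (x * y) = f x * f y by exact: rmorphM.
have fX x n : f (x ^+ n) = f x ^+ n by exact: rmorphXn.
have fZ c x : f (c *: x) = c *: f x by exact: linearZ.
have f1 : f 1 = 1 by exact: rmorph1.
have gE : f gen_E = 0.
  by rewrite /f free_eval_gen /g -val_eqE /= !inordK.
have gF : f gen_F = 0.
  by rewrite /f free_eval_gen /g -val_eqE /= !inordK.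
have gK : f gen_K = 1 by rewrite /f free_eval_gen /g eqxx.
have p_gt0 : (0 < p)%N by apply: ltnW.
have fr r : r \in Uq_relations -> f r = 0.
  rewrite !inE => /or4P[/eqP->|/eqP->|/eqP->|/or3P[] /eqP->].
  - by rewrite fX gE expr0n gtn_eqF.
  - by rewrite fX gF expr0n gtn_eqF.
  - by rewrite fB fX gK expr1n f1 subrr.
  - by rewrite fB !fM fZ gE mulr0 mul0r scaler0 subr0.
  - by rewrite fB !fM fZ gF mulr0 mul0r scaler0 subr0.
  by rewrite !fB !fM fZ fB fX gE gF gK expr1n mulr0 !subrr scaler0 subrr.
move=> h; have : f 1 = 0.
  elim: h => [|a r b x rR _ IH]; first by rewrite -[X in f X](subrr 0) fB subrr.
  by rewrite fD !fM (fr r rR) IH mulr0 mul0r addr0.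
by rewrite f1 => /eqP; rewrite oner_eq0.
Qed.

Hypothesis p_gt1 : (1 < p)%N.

Definition Uq : Type := presented_algebra (Uq_proper p_gt1).
HB.instance Definition _ := GRing.Algebra.on Uq.

Definition Uq_E : Uq := pres_pi (Uq_proper p_gt1) gen_E.
Definition Uq_F : Uq := pres_pi (Uq_proper p_gt1) gen_F.
Definition Uq_K : Uq := pres_pi (Uq_proper p_gt1) gen_K.

Local Notation E := Uq_E.
Local Notation F := Uq_F.
Local Notation K := Uq_K.

Definition Uq_Kinv : Uq := K ^+ (2 * p).-1.

Definition qint (n : nat) : k := (q ^+ n - q ^- n) / (q - q^-1).

(* In v_p, a0 and e_idem, the sign s is 1 or -1. *)
Definition v_p (s : k) : Uq :=
  \sum_(l < 2 * p) (s * q ^- p.-1) ^+ l *: K ^+ l.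

Definition a0 (s : k) : Uq := E ^+ p.-1 * F ^+ p.-1 * v_p s.

Definition e_idem (s : k) : Uq :=
  ((2 * p)%:R * \prod_(1 <= i < p) (s * qint i * qint (p - i)))^-1 *: a0 s.

Definition casimir : Uq :=
  E * F + ((q - q^-1) ^+ 2)^-1 *: (q^-1 *: K + q *: Uq_Kinv).

Definition casimir_eigenvalue (j : nat) : k :=
  (q ^+ j + q ^- j) / (q - q^-1) ^+ 2.

(* The generalized eigenspace of the Casimir element, which acts by
   multiplication. *)
Definition Qblock (s : nat) : set Uq :=
  [set x | exists n : nat, (casimir - (casimir_eigenvalue s)%:A) ^+ n * x = 0].

End RestrictedQuantumGroup.

Arguments Uq_proper {k p} q p_gt1 _.
Arguments Uq {k p} q p_gt1.
Arguments Uq_E {k p} q p_gt1.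
Arguments Uq_F {k p} q p_gt1.
Arguments Uq_K {k p} q p_gt1.
Arguments casimir {k p} q p_gt1.
Arguments e_idem {k p} q p_gt1 s.
Arguments Qblock {k p} q p_gt1 s _.

Definition corner (A : pzRingType) (e : A) (X : set A) : set A :=
  [set e * x * e | x in X].

Definition is_unital_algebra (k : fieldType) (A : algType k) (e : A)
    (B : set A) : Prop :=
  [/\ forall (c : k) (x y : A), B x -> B y -> B (c *: x + y),
      forall x y : A, B x -> B y -> B (x * y),
      B e
    & forall x : A, B x -> e * x = x /\ x * e = x].

Definition is_commutative (A : pzRingType) (B : set A) : Prop :=
  forall x y : A, B x -> B y -> x * y = y * x.

(* B has a basis of n vectors; used for B a linear subspace. *)
Definition has_dimension (k : fieldType) (V : lmodType k) (B : set V)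
    (n : nat) : Prop :=
  exists b : 'I_n -> V,
    [/\ forall i, B (b i),
        forall c : 'I_n -> k, \sum_i c i *: b i = 0 -> forall i, c i = 0
      & forall x, B x -> exists c : 'I_n -> k, x = \sum_i c i *: b i].

(* exp(pi i / p) *)
Definition qroot (R : realType) (p : nat) : R[i] :=
  (cos (pi / p%:R) +i* sin (pi / p%:R))%C.

(* Main.v *)
(* With lambda_n = s [n]^2 and q^p = -1, a vector w with E w = 0 and
   K w = s q^(p-1) w satisfies E F^n w = lambda_n F^(n-1) w, so E^(p-1) F^(p-1) v_p
   acts on w by the scalar which e_p divides out: e_p w = w.  As e = e_p is itself
   such a vector of the left regular module, e is idempotent, is an eigenvector of
   the Casimir element, and U e is spanned by the F^n e.  Moreover e F^n e = 0 for
   n > 0, since the factor F^(p-1) of e gives F^(p-1+n) = 0; hence e U e = k e.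
   Finally e <> 0 because it fixes the highest weight vector of the p-dimensional
   simple module. *)
Require Import Defs.
From mathcomp Require Import all_boot all_algebra.
From mathcomp Require Import all_classical all_reals all_analysis.
From mathcomp Require Import complex.
From mathcomp Require Import -(notations) monalg.
From mathcomp Require Import all_order ring lra zify.

Set Implicit Arguments.
Unset Strict Implicit.
Unset Printing Implicit Defensive.

Import Order.TTheory GRing.Theory Num.Theory.
Local Open Scope ring_scope.

(** * Spans of families, and induction over the words of a free algebra *)

Inductive in_span (k : fieldType) (V : lmodType k) (I : Type) (b : I -> V) : V -> Prop :=
| in_span0 : in_span b 0
| in_spanD c i y : in_span b y -> in_span b (c *: b i + y).

Section Span.
Variables (k : fieldType) (V : lmodType k) (I : Type) (b : I -> V).

Lemma in_span_gen i : in_span b (b i).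
Proof. by rewrite -[b i]scale1r -[_ *: _]addr0; apply/in_spanD/in_span0. Qed.

Lemma in_span_lin c y z : in_span b y -> in_span b z -> in_span b (c *: y + z).
Proof.
move=> hy hz; elim: hy => [|a i t _ IH]; first by rewrite scaler0 add0r.
by rewrite scalerDr scalerA -addrA; apply: in_spanD.
Qed.

(** Induction over a span: [P] stands for a subspace and [f], in the applications, for left
    multiplication, so stability need only be tested on the family [b]. *)
Lemma in_span_linear (W : lmodType k) (f : V -> W) (P : W -> Prop) y :
  linear f -> P 0 -> (forall c x z, P x -> P z -> P (c *: x + z)) ->
  (forall i, P (f (b i))) -> in_span b y -> P (f y).
Proof.
move=> fL P0 PD Pb; elim=> [|c i z _ IH]; last by rewrite fL; apply: PD.
by rewrite -[0](addNr 0) -scaleN1r fL scaleN1r addNr.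
Qed.

End Span.

Lemma mulr_linear (k : fieldType) (A : algType k) (y : A) : linear ( *%R y).
Proof. by move=> c u v; rewrite mulrDr scalerAr. Qed.

(** Every element is a linear combination of words, and a word is built from 1 by putting one letter
    at a time on its left. *)
Lemma free_algebra_ind (k : fieldType) (X : choiceType)
    (P : free_algebra k X -> Prop) :
  (forall c x y, P x -> P y -> P (c *: x + y)) -> P 1 ->
  (forall i x, P x -> P (free_gen k i * x)) -> forall x, P x.
Proof.
move=> PL P1 PM x.
have P0 : P 0 by rewrite -[0](addNr 1) -scaleN1r; apply: PL.
have Pw (l : seq X) : P (\prod_(i <- l) free_gen k i).
  by elim: l => [|i l IH]; rewrite ?big_nil ?big_cons //; apply: PM.
(* The word [m] and its list of letters [l] are kept apart so that the induction runs on a plain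
   sequence. *)
have w1 (l : seq X) (m : fmonom X) : (m : seq X) = l ->
    \prod_(i <- l) free_gen k i = mkmalgU m 1 :> free_algebra k X.
  elim: l m => [|i l IH] m ml.
    by rewrite big_nil; congr (mkmalgU _ _); apply/val_inj; rewrite /= ml fm1.
  rewrite big_cons (IH (FMonom l)) // [LHS]fgmulUU mulr1.
  by congr (mkmalgU _ _); apply/val_inj; rewrite /= fmM fmU ml.
have wE (m : fmonom X) c :
    mkmalgU m c = c *: \prod_(i <- (m : seq X)) free_gen k i :> free_algebra k X.
  rewrite (w1 _ m) //; apply/malgP => m'.
  by rewrite mcoeffZ !mcoeffU mulrnAr mulr1.
rewrite [x]monalgE; elim/big_rec: _ => // m y _ Py.
by rewrite wE; apply: PL.
Qed.

(** * Triples in an arbitrary algebra that satisfy the relations of the quantum group *)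

Section UqTriples.
Variables (k : fieldType) (p : nat) (q : k).

(** Any algebra is allowed because the computations serve twice: for the generators of [Uq] and for
    the matrices of a p-dimensional module. *)
Record Uq_triple (A : algType k) (E F K : A) : Prop := UqTriple {
  triple_Ep : E ^+ p = 0;
  triple_Fp : F ^+ p = 0;
  triple_Kp : K ^+ (2 * p) = 1;
  triple_KEKinv : K * E * K ^+ (2 * p).-1 = q ^+ 2 *: E;
  triple_KFKinv : K * F * K ^+ (2 * p).-1 = q ^- 2 *: F;
  triple_EF : E * F - F * E = (q - q^-1)^-1 *: (K - K ^+ (2 * p).-1) }.

Hypothesis p_gt1 : (1 < p)%N.

(** As [K ^+ (2 * p) = 1], one more factor [K] on the right cancels [K ^+ (2 * p).-1]. *)
Lemma triple_conj (A : algType k) (E F K X : A) c : Uq_triple E F K ->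
  K * X * K ^+ (2 * p).-1 = c *: X -> K * X = c *: (X * K).
Proof.
move=> T h; rewrite scalerAl -h -[RHS]mulrA -exprSr prednK ?(triple_Kp T) ?mulr1 //.
by lia.
Qed.

Lemma triple_KE (A : algType k) (E F K : A) :
  Uq_triple E F K -> K * E = q ^+ 2 *: (E * K).
Proof. by move=> T; apply: (triple_conj T); apply: triple_KEKinv T. Qed.

Lemma triple_KF (A : algType k) (E F K : A) :
  Uq_triple E F K -> K * F = q ^- 2 *: (F * K).
Proof. by move=> T; apply: (triple_conj T); apply: triple_KFKinv T. Qed.

End UqTriples.

(* On the generators of the free algebra this is convertible to Uq_relations. *)
Definition triple_rels (k : fieldType) (p : nat) (q : k) (A : algType k)
    (E F K : A) : seq A :=
  [:: E ^+ p; F ^+ p; K ^+ (2 * p) - 1;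
      K * E * K ^+ (2 * p).-1 - q ^+ 2 *: E;
      K * F * K ^+ (2 * p).-1 - q ^- 2 *: F;
      E * F - F * E - (q - q^-1)^-1 *: (K - K ^+ (2 * p).-1)].

(** The named fields suit computations, while the list of relators is what algebra morphisms
    transport. *)
Lemma triple_relsP (k : fieldType) (p : nat) (q : k) (A : algType k) (E F K : A) :
  Uq_triple p q E F K <-> (forall r, r \in triple_rels p q E F K -> r = 0).
Proof.
split=> [T r|rel].
  rewrite !inE => /or4P[/eqP->|/eqP->|/eqP->|/or3P[] /eqP->].
  - exact: triple_Ep T.
  - exact: triple_Fp T.
  - by rewrite (triple_Kp T) subrr.
  - by rewrite (triple_KEKinv T) subrr.
  - by rewrite (triple_KFKinv T) subrr.
  by rewrite (triple_EF T) subrr.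
have {}rel i : (i < 6)%N -> (triple_rels p q E F K)`_i = 0.
  by move=> i6; apply/rel/mem_nth.
split; [exact: rel 0 isT|exact: rel 1 isT| | | |]; apply/eqP; rewrite -subr_eq0.
- exact/eqP/(rel 2).
- exact/eqP/(rel 3).
- exact/eqP/(rel 4).
exact/eqP/(rel 5).
Qed.

Lemma map_triple_rels (k : fieldType) (p : nat) (q : k) (A B : algType k)
    (f : {lrmorphism A -> B}) (E F K : A) :
  map f (triple_rels p q E F K) = triple_rels p q (f E) (f F) (f K).
Proof.
have fB x y : f (x - y) = f x - f y by exact: raddfB.
have fZ c x : f (c *: x) = c *: f x by exact: linearZ.
by rewrite /= !fB !fZ fB !rmorphM !rmorphXn rmorph1.
Qed.

(** * Induction on [Uq] and maps out of it *)

Section Presentation.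
Variables (k : fieldType) (p : nat) (q : k) (p_gt1 : (1 < p)%N).

Local Notation pi := (pres_pi (Uq_proper q p_gt1)).

Lemma Uq_rel r : r \in Uq_relations p q -> pi r = 0.
Proof.
move=> rR; rewrite -(linear0 pi); apply/pres_pi_eq.
by rewrite subr0 -[r]mul1r -[_ * r]mulr1 -[_ * 1]addr0; apply/in_idealD/in_ideal0.
Qed.

Lemma Uq_generators_triple :
  Uq_triple p q (Uq_E q p_gt1) (Uq_F q p_gt1) (Uq_K q p_gt1).
Proof.
apply/(@triple_relsP _ _ _ (presented_algebra (Uq_proper q p_gt1))) => r.
rewrite -map_triple_rels => /mapP[r0 r0R ->]; exact: Uq_rel.
Qed.

Lemma Uq_ind (P : Uq q p_gt1 -> Prop) :
  (forall c x y, P x -> P y -> P (c *: x + y)) -> P 1 ->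
  (forall x, P x -> P (Uq_E q p_gt1 * x)) ->
  (forall x, P x -> P (Uq_F q p_gt1 * x)) ->
  (forall x, P x -> P (Uq_K q p_gt1 * x)) -> forall x, P x.
Proof.
move=> PL P1 PE PF PK x; rewrite -(pres_repr x).
elim/free_algebra_ind: (repr x) => [c y z Py Pz||i y Py].
- by rewrite linearP; apply: PL.
- by rewrite rmorph1.
rewrite rmorphM.
have [->|[->|->]] : i = inord 0 \/ (i = inord 1 \/ i = inord 2).
  case: i => -[|[|[|//]]] hi; [left|right; left|right; right]; apply/val_inj;
    by rewrite /= inordK.
- exact: PE.
- exact: PF.
exact: PK.
Qed.

(** The universal property, with the morphism kept on the free algebra: vanishing on the kernel of
    [pi] stands for factoring through the quotient. *)
Lemma Uq_lift (A : algType k) (E F K : A) : Uq_triple p q E F K ->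
  exists f : {lrmorphism free_algebra k 'I_3 -> A},
    [/\ forall x, pi x = 0 -> f x = 0,
        f (gen_E k) = E, f (gen_F k) = F & f (gen_K k) = K].
Proof.
move=> T.
have [f [gE gF gK]] : exists f : {lrmorphism free_algebra k 'I_3 -> A},
    [/\ f (gen_E k) = E, f (gen_F k) = F & f (gen_K k) = K].
  by exists (@free_eval k 'I_3 A (fun i => [:: E; F; K]`_i)); split;
    rewrite /= free_eval_gen inordK.
exists f; split=> // x; rewrite -(linear0 pi) => /pres_pi_eq; rewrite subr0.
have fr r : r \in Uq_relations p q -> f r = 0.
  move=> rR; move/triple_relsP: T; apply.
  by rewrite -gE -gF -gK -map_triple_rels; apply: map_f.
have fD y z : f (y + z) = f y + f z by exact: raddfD.
have fM y z : f (y * z) = f y * f z by exact: rmorphM.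
elim=> [|a r b y rR _ IH]; first exact: linear0.
by rewrite fD !fM (fr r rR) IH mulr0 mul0r addr0.
Qed.

End Presentation.

Lemma idempotent_scale (k : fieldType) (A : algType k) (e : A) c :
  e * e = e -> e * (c *: e) * e = c *: e.
Proof. by move=> ee; rewrite -scalerAr -scalerAl !ee. Qed.

Lemma eigenvector_scale (k : fieldType) (A : algType k) (x e : A) b c :
  x * e = b *: e -> (x - b%:A) ^+ 1 * (c *: e) = 0.
Proof. by move=> xe; rewrite expr1 -scalerAr mulrBl xe mulr_algl subrr scaler0. Qed.

Lemma eigenvector_exp (k : fieldType) (A : algType k) (x y : A) (c : k) n :
  x * y = c *: y -> x ^+ n * y = c ^+ n *: y.
Proof.
move=> xy; elim: n => [|n IH]; first by rewrite !expr0 mul1r scale1r.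
by rewrite exprS -mulrA IH -scalerAr xy scalerA exprSr.
Qed.

(** * The weights and structure constants at q^p = -1 *)

Section HighestWeightVectors.
Variables (k : fieldType) (p : nat) (q s : k).
Hypothesis p_gt1 : (1 < p)%N.
Hypothesis qp : q ^+ p = -1.
Hypothesis ss : s * s = 1.
Hypothesis qq : q - q^-1 != 0.

(* The K-weight of F^n w and the factor in E F^n w = hw_lambda n F^(n-1) w, for w of
   weight s q^(p-1), using q^p = -1 and s^2 = 1. *)
Definition hw_kappa (n : nat) : k := - s * q ^- (2 * n).+1.
Definition hw_lambda (n : nat) : k := s * qint q n ^+ 2.

Lemma q_neq0 : q != 0.
Proof.
apply/eqP => q0; move: qp; rewrite q0 expr0n; case: (p) p_gt1 => // n _ /=.
by move/esym/eqP; rewrite oppr_eq0 oner_eq0.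
Qed.

Lemma q2B1_neq0 : q ^+ 2 - 1 != 0.
Proof.
have q0 := q_neq0; apply: contraNneq qq => h.
have -> : q - q^-1 = (q ^+ 2 - 1) / q by field.
by rewrite h mul0r.
Qed.

Lemma s_neq0 : s != 0.
Proof. by apply: contra_eq_neq ss => ->; rewrite mulr0 eq_sym oner_eq0. Qed.

Lemma s_inv : s^-1 = s.
Proof. by apply: (mulfI s_neq0); rewrite ss mulfV // s_neq0. Qed.

Lemma hw_kappa_neq0 n : hw_kappa n != 0.
Proof. by rewrite mulf_neq0 ?invr_eq0 ?expf_neq0 ?q_neq0 // oppr_eq0 s_neq0. Qed.

Lemma hw_kappa_exp n : hw_kappa n ^+ (2 * p) = 1.
Proof.
rewrite exprMn exprVn -exprM.
have -> : ((2 * n).+1 * (2 * p) = p * (2 * (2 * n).+1))%N by lia.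
by rewrite !exprM qp sqrrN sqrrN expr1n expr2 ss !expr1n invr1 mulr1.
Qed.

Lemma hw_kappa_exp_pred n : hw_kappa n ^+ (2 * p).-1 = (hw_kappa n)^-1.
Proof.
have p2 : (0 < 2 * p)%N by lia.
apply: (mulfI (hw_kappa_neq0 n)).
by rewrite -exprS prednK // hw_kappa_exp mulfV // hw_kappa_neq0.
Qed.

(** From q^p = -1 follows q^(p-n) = -q^(-n), so the two terms of the numerator trade places. *)
Lemma qint_subn n : (n <= p)%N -> qint q (p - n) = qint q n.
Proof.
move=> np; rewrite /qint; congr (_ / _).
have -> : q ^+ (p - n) = - q ^- n.
  have qn0 : q ^+ n != 0 by rewrite expf_neq0 ?q_neq0.
  by apply: (mulIf qn0); rewrite -exprD subnK // qp mulNr mulVf.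
by rewrite invrN invrK opprK addrC.
Qed.

Lemma hw_lambda0 : hw_lambda 0 = 0.
Proof. by rewrite /hw_lambda /qint !expr0 invr1 subrr mul0r expr0n mulr0. Qed.

(** This is [n+1]^2 - [n]^2 = [2n+1], multiplied by s; the increment is what the commutator of E and
    F contributes on F^n w. *)
Lemma hw_lambdaS n :
  hw_lambda n.+1 = hw_lambda n
    + (q - q^-1)^-1 * (hw_kappa n - (hw_kappa n)^-1).
Proof.
have q0 := q_neq0.
have qn0 : q ^+ n != 0 by rewrite expf_neq0.
rewrite /hw_lambda /hw_kappa /qint invfM invrK invrN s_inv.
rewrite !exprS mulnC exprM expr2.
set x := q ^+ n in qn0 *.
have d0 := q2B1_neq0.
by field; rewrite ?q0 ?qn0 ?d0.
Qed.

Definition triple_a0 (A : algType k) (E F K : A) : A :=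
  E ^+ p.-1 * F ^+ p.-1 * (\sum_(l < 2 * p) (s * q ^- p.-1) ^+ l *: K ^+ l).

Definition e_coef : k := (2 * p)%:R * \prod_(1 <= i < p) (s * qint q i * qint q (p - i)).

Lemma q_exp_predN : q ^- p.-1 = - q.
Proof.
have q0 := q_neq0.
apply: (mulIf (expf_neq0 p.-1 q0)).
by rewrite mulVf ?expf_neq0 // mulNr -exprS prednK ?qp ?opprK // ltnW.
Qed.

(** The coefficients of v_p are thus powers of the inverse highest weight, so every summand of v_p
    fixes a vector of that weight. *)
Lemma hw_kappa0_inv : (hw_kappa 0)^-1 = s * q ^- p.-1.
Proof.
have q0 := q_neq0.
by rewrite q_exp_predN /hw_kappa muln0 expr1 invfM invrK invrN s_inv mulNr mulrN.
Qed.

Lemma e_coefE : e_coef = (2 * p)%:R * \prod_(1 <= i < p) hw_lambda i.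
Proof.
congr (_ * _); apply: eq_big_nat => i /andP[_ ip].
by rewrite qint_subn ?(ltnW ip) // -mulrA -expr2.
Qed.

(** * The action of a triple on the vectors F^n w *)

Section Action.
Variables (A : algType k) (E F K w : A).
Hypothesis T : Uq_triple p q E F K.
Hypothesis Ew : E * w = 0.
Hypothesis Kw : K * w = hw_kappa 0 *: w.

Lemma hw_K n : K * (F ^+ n * w) = hw_kappa n *: (F ^+ n * w).
Proof.
elim: n => [|n IH]; first by rewrite expr0 mul1r.
rewrite exprS -mulrA mulrA (triple_KF p_gt1 T) -scalerAl -mulrA IH -scalerAr scalerA.
congr (_ *: _); rewrite /hw_kappa mulrCA; congr (_ * _).
by rewrite -invfM -exprD; congr (_ ^- _); lia.
Qed.

Lemma hw_Kinv n : K ^+ (2 * p).-1 * (F ^+ n * w) = (hw_kappa n)^-1 *: (F ^+ n * w).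
Proof. by rewrite (eigenvector_exp _ (hw_K n)) hw_kappa_exp_pred. Qed.

Lemma hw_EF n : E * (F ^+ n * w) = hw_lambda n *: (F ^+ n.-1 * w).
Proof.
elim: n => [|n IH]; first by rewrite expr0 mul1r Ew hw_lambda0 scale0r.
have EF : E * F = F * E + (q - q^-1)^-1 *: (K - K ^+ (2 * p).-1).
  by rewrite -(triple_EF T) addrC subrK.
rewrite exprS -mulrA mulrA EF mulrDl -mulrA IH -scalerAl mulrBl hw_K hw_Kinv.
rewrite -scalerBl scalerA hw_lambdaS scalerDl -scalerAr mulrA -exprS; congr (_ + _).
(* For n = 0 the truncated exponent [n.-1] makes F * F^(n-1) differ from F^n, but [hw_lambda 0]
   vanishes. *)
by case: n {IH} => [|n] //=; rewrite hw_lambda0 !scale0r.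
Qed.

Lemma hw_EFn n : E ^+ n * (F ^+ n * w) = (\prod_(1 <= i < n.+1) hw_lambda i) *: w.
Proof.
elim: n => [|n IH]; first by rewrite big_nil !expr0 !mul1r scale1r.
by rewrite exprSr -mulrA hw_EF -scalerAr IH scalerA [in RHS]big_nat_recr //= mulrC.
Qed.

(** The sum v_p acts on w by 2p, and E^(p-1) F^(p-1) by the product of the [hw_lambda i]. *)
Lemma triple_a0_hw : triple_a0 E F K * w = e_coef *: w.
Proof.
rewrite /triple_a0 -mulrA mulr_suml.
under eq_bigr do rewrite -scalerAl (eigenvector_exp _ Kw) -hw_kappa0_inv scalerA -exprMn
  mulVf ?hw_kappa_neq0 // expr1n scale1r.
rewrite sumr_const card_ord -scaler_nat -scalerAr -mulrA hw_EFn scalerA e_coefE.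
by rewrite prednK // ltnW.
Qed.

End Action.

(** * The element e as a highest weight vector, and its corner *)

Section Idempotent.
Variables (A : algType k) (E F K : A).
Hypothesis T : Uq_triple p q E F K.

Local Notation v := (\sum_(l < 2 * p) (s * q ^- p.-1) ^+ l *: K ^+ l).

Lemma triple_a0_E : E * triple_a0 E F K = 0.
Proof.
by rewrite /triple_a0 !mulrA -exprS prednK ?(triple_Ep T) ?mul0r // ltnW.
Qed.

Lemma triple_K_expE n : K * E ^+ n = q ^+ (2 * n) *: (E ^+ n * K).
Proof.
elim: n => [|n IH]; first by rewrite muln0 !expr0 mulr1 mul1r scale1r.
rewrite exprSr mulrA IH -scalerAl -[_ * K * E]mulrA (triple_KE p_gt1 T).
rewrite -scalerAr scalerA -exprD mulrA.
by congr (q ^+ _ *: _); lia.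
Qed.

Lemma triple_K_expF n : K * F ^+ n = q ^- (2 * n) *: (F ^+ n * K).
Proof.
elim: n => [|n IH]; first by rewrite muln0 !expr0 invr1 mulr1 mul1r scale1r.
rewrite exprSr mulrA IH -scalerAl -[_ * K * F]mulrA (triple_KF p_gt1 T).
rewrite -scalerAr scalerA -invfM -exprD mulrA.
by congr (q ^- _ *: _); lia.
Qed.

(** Multiplication by K shifts the summation index cyclically; the cycle closes because K and its
    weight both have 2p-th power 1. *)
Lemma triple_K_v : K * v = hw_kappa 0 *: v.
Proof.
have c0 := hw_kappa_neq0 0.
have p2 : (0 < 2 * p)%N by lia.
rewrite -hw_kappa0_inv mulr_sumr scaler_sumr.
case: (2 * p)%N p2 (triple_Kp T) (hw_kappa_exp 0) => // m _ Km cm.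
(* The last summand on the left is matched with the first one on the right. *)
rewrite big_ord_recr [RHS]big_ord_recl /= addrC; congr (_ + _).
  rewrite -scalerAr -exprS Km expr0 scale1r expr0.
  rewrite exprVn; congr (_ *: _).
  by apply: (mulIf (expf_neq0 m c0)); rewrite mulVf ?expf_neq0 // -exprS cm.
apply: eq_bigr => i _; rewrite -scalerAr -exprS scalerA; congr (_ *: _).
by rewrite exprS mulrA mulfV // mul1r.
Qed.

(** Passing K through E^(p-1) and F^(p-1) yields inverse powers of q, so the weight is that of
    v_p. *)
Lemma triple_a0_K : K * triple_a0 E F K = hw_kappa 0 *: triple_a0 E F K.
Proof.
rewrite /triple_a0 !mulrA triple_K_expE -scalerAl -[E ^+ _ * K * _]mulrA triple_K_expF.
rewrite -scalerAr scalerA mulfV ?expf_neq0 ?q_neq0 // scale1r.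
by rewrite -!mulrA triple_K_v -!scalerAr.
Qed.

Hypothesis e_coef_neq0 : e_coef != 0.

Local Notation e := (e_coef^-1 *: triple_a0 E F K).

Lemma triple_e_E : E * e = 0.
Proof. by rewrite -scalerAr triple_a0_E scaler0. Qed.

Lemma triple_e_K : K * e = hw_kappa 0 *: e.
Proof. by rewrite -scalerAr triple_a0_K !scalerA mulrC. Qed.

Lemma triple_e_hw (w : A) : E * w = 0 -> K * w = hw_kappa 0 *: w -> e * w = w.
Proof.
by move=> Ew Kw; rewrite -scalerAl triple_a0_hw // scalerA mulVf // scale1r.
Qed.

(** On the weight vector F^(n+1) e the sum v_p acts by a scalar; then F^(p-1) meets F^(n+1) and
    gives 0. *)
Lemma triple_e_F n : e * (F ^+ n.+1 * e) = 0.
Proof.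
have Kz := hw_K T triple_e_K n.+1.
have Fz : F ^+ p.-1 * (F ^+ n.+1 * e) = 0.
  rewrite mulrA -exprD; have -> : (p.-1 + n.+1 = p + n)%N by lia.
  by rewrite exprD (triple_Fp T) !mul0r.
move: (F ^+ n.+1 * e) Kz Fz => z Kz Fz.
rewrite -scalerAl /triple_a0 -!mulrA mulr_suml.
under eq_bigr do rewrite -scalerAl (eigenvector_exp _ Kz) scalerA.
by rewrite -scaler_suml -!scalerAr Fz mulr0 !scaler0.
Qed.

(** E, F and K generate the algebra; for [Uq] this is [Uq_ind]. *)
Hypothesis ind : forall P : A -> Prop,
  (forall c x y, P x -> P y -> P (c *: x + y)) -> P 1 ->
  (forall x, P x -> P (E * x)) -> (forall x, P x -> P (F * x)) ->
  (forall x, P x -> P (K * x)) -> forall x, P x.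

(** The span contains e and is stable under E, F and K, which lower, raise and rescale the vectors
    F^n e. *)
Lemma triple_mul_e x : in_span (fun n => F ^+ n * e) (x * e).
Proof.
set b := fun n => _.
have mulS (y : A) : (forall n, in_span b (y * b n)) ->
    forall z, in_span b z -> in_span b (y * z).
  move=> yb z; apply: (in_span_linear (mulr_linear y)) => //; first exact: in_span0.
  exact: in_span_lin.
have bZ c n : in_span b (c *: b n).
  by rewrite -[_ *: _]addr0; apply/in_spanD/in_span0.
elim/ind: x => [c x y hx hy||x hx|x hx|x hx].
- by rewrite mulrDl -scalerAl; apply: in_span_lin.
- by rewrite mul1r -[X in in_span _ X]mul1r; apply: (in_span_gen b 0).
- rewrite -mulrA; apply: mulS => // n.
  by rewrite (hw_EF T triple_e_E triple_e_K); apply: bZ.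
- rewrite -mulrA; apply: mulS => // n.
  by rewrite /b mulrA -exprS; apply: (in_span_gen b).
by rewrite -mulrA; apply: mulS => // n; rewrite (hw_K T triple_e_K); apply: bZ.
Qed.

Lemma triple_e_corner x : exists c, e * x * e = c *: e.
Proof.
rewrite -mulrA; pose P y := exists c, y = c *: e; rewrite -/(P _).
apply: (@in_span_linear _ _ _ _ _ ( *%R e) P _ _ _ _ _ (triple_mul_e x)).
- exact: mulr_linear.
- by exists 0; rewrite scale0r.
- by move=> c _ _ [a ->] [b ->]; exists (c * a + b); rewrite scalerDl -(scalerA c).
(* Only n = 0 contributes, with coefficient 1 because e e = e. *)
move=> [|n]; last by exists 0; rewrite triple_e_F scale0r.
by exists 1; rewrite expr0 mul1r triple_e_hw ?scale1r ?triple_e_E ?triple_e_K.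
Qed.

(** Here E F w = s w, while K and its inverse act by -s q^(-1) and -s q; the sum collapses to -2s /
    (q - q^(-1))^2. *)
Lemma triple_casimir (w : A) : E * w = 0 -> K * w = hw_kappa 0 *: w ->
  (E * F + ((q - q^-1) ^+ 2)^-1 *: (q^-1 *: K + q *: K ^+ (2 * p).-1)) * w
  = (- (s + s) / (q - q^-1) ^+ 2) *: w.
Proof.
move=> Ew Kw; rewrite mulrDl -mulrA -scalerAl mulrDl -!scalerAl Kw.
have := hw_Kinv T Kw 0; rewrite expr0 mul1r => ->.
have := hw_EF T Ew Kw 1; rewrite expr1 /= expr0 mul1r => ->.
rewrite !scalerA -scalerDl scalerA -scalerDl; congr (_ *: _).
have q0 := q_neq0.
rewrite /hw_lambda /qint !expr1 divff // expr1n mulr1 hw_kappa0_inv q_exp_predN.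
rewrite /hw_kappa muln0 expr1.
have d0 := q2B1_neq0.
by field; rewrite ?q0 ?d0.
Qed.

End Idempotent.

(** * The p-dimensional simple module, realized by matrices *)

Lemma Uq_triple_module : exists (A : algType k) (E F K w : A),
  [/\ Uq_triple p q E F K, E * w = 0, K * w = hw_kappa 0 *: w & w != 0].
Proof.
(* The size is p, written as a successor so that the square matrices form a nonzero algebra. *)
pose A := 'M[k]_(p.-1.+1).
have pP : p.-1.+1 = p by rewrite prednK // ltnW.
pose E : A := \matrix_(i, j) ((i.+1 == j :> nat)%:R * hw_lambda j).
pose F : A := \matrix_(i, j) (i == j.+1 :> nat)%:R.
pose K : A := \matrix_(i, j) ((i == j :> nat)%:R * hw_kappa j).
(* Basis vectors are stored in the first column of a square matrix: they then lie in the algebra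
   itself, and the module action is left multiplication. *)
pose b n : A := \matrix_(i, j) ((i == n :> nat) && (j == 0))%:R.
have b0 n : (p <= n)%N -> b n = 0.
  move=> pn; apply/matrixP => i j; rewrite !mxE.
  by rewrite [_ == n](ltn_eqF _) // (leq_trans (ltn_ord i)) // pP.
have bE (M : A) i j (n : 'I_p.-1.+1) : (M * b n) i j = M i n * (j == 0)%:R.
  rewrite mxE (bigD1 n) //= big1 => [|l ln].
    by rewrite mxE eqxx addr0.
  by rewrite mxE -val_eqE in ln *; rewrite (negPf ln) mulr0.
have bext (M N : A) : (forall n, M * b n = N * b n) -> M = N.
  move=> h; apply/matrixP => i j; move/matrixP/(_ i 0): (h j).
  by rewrite !bE eqxx !mulr1.
(* The second condition covers indices beyond the basis, so that the formula holds for every natural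
   number n. *)
have bP (M : A) (c : nat -> k) (g : nat -> nat) :
    (forall i n : 'I_p.-1.+1, M i n = c n * (i == g n :> nat)%:R) ->
    (forall n, (p <= n)%N -> c n *: b (g n) = 0) ->
    forall n, M * b n = c n *: b (g n).
  move=> h hp n; case: (ltnP n p) => [np|pn]; last by rewrite b0 // mulr0 hp.
  rewrite -pP in np; apply/matrixP => i j.
  by rewrite (bE M i j (Ordinal np)) h !mxE -mulrA -natrM mulnb.
have bF n : F * b n = b n.+1.
  rewrite (bP _ (fun=> 1) S) ?scale1r // => [i m|m pm]; first by rewrite mxE mul1r.
  by rewrite scale1r b0 // ltnW.
have bK n : K * b n = hw_kappa n *: b n.
  by rewrite (bP _ hw_kappa id) // => [i m|m pm]; rewrite ?mxE 1?mulrC // b0 ?scaler0.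
have l0 := hw_lambda0.
(* At n = p the vector [b p] is 0 but [b p.-1] is not, so the formula for E relies on this zero. *)
have lp : hw_lambda p = 0.
  by rewrite /hw_lambda /qint qp invrN invr1 subrr mul0r expr0n mulr0.
have bL n : E * b n = hw_lambda n *: b n.-1.
  rewrite (bP _ hw_lambda predn) // => [i [[|m] hm]|m].
  - by rewrite mxE /= l0 mulr0 mul0r.
  - by rewrite mxE /= eqSS mulrC.
  rewrite leq_eqVlt => /predU1P[<-|pm]; first by rewrite lp scale0r.
  by rewrite b0 ?scaler0 //; lia.
have q0 := q_neq0.
(* Neighbouring weights differ by q^2, which gives the conjugation relations of K with E and F. *)
have kS n : hw_kappa n = q ^+ 2 * hw_kappa n.+1.
  rewrite /hw_kappa; have -> : ((2 * n.+1).+1 = 2 + (2 * n).+1)%N by lia.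
  by rewrite exprD; field; rewrite ?expf_neq0 ?q0.
have bKi n : K ^+ (2 * p).-1 * b n = (hw_kappa n)^-1 *: b n.
  by rewrite (eigenvector_exp _ (bK n)) hw_kappa_exp_pred.
have bFn m n : F ^+ m * b n = b (n + m)%N.
  elim: m => [|m IH]; first by rewrite expr0 mul1r addn0.
  by rewrite exprS -mulrA IH bF addnS.
have bEn m n : (n < m)%N -> E ^+ m * b n = 0.
  elim: m n => // m IH n nm; rewrite exprSr -mulrA bL -scalerAr.
  case: n nm => [_|n nm]; first by rewrite l0 scale0r.
  by rewrite IH ?scaler0.
exists A, E, F, K, (b 0%N); split; last 1 first.
- apply/eqP => /matrixP/(_ 0 0)/eqP; rewrite !mxE eqxx /=.
  by rewrite oner_eq0.
- split; apply: bext => n; rewrite ?mul0r ?mul1r.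
  + by case: (ltnP n p) => [/bEn //|/b0 ->]; rewrite mulr0.
  + by rewrite bFn b0 // leq_addl.
  + by rewrite (eigenvector_exp _ (bK n)) hw_kappa_exp scale1r.
  + rewrite -!mulrA bKi -!scalerAr bL -scalerAr bK -scalerAl bL !scalerA.
    case: n => [|n]; first by rewrite l0 !(mul0r, mulr0) !scale0r.
    congr (_ *: _); rewrite /= (kS n); field; exact: hw_kappa_neq0.
  + rewrite -!mulrA bKi -!scalerAr bF bK -scalerAl bF !scalerA.
    congr (_ *: _); rewrite (kS n); field; by rewrite hw_kappa_neq0 q0.
  rewrite mulrBl -!mulrA bF !bL -scalerAr bF /= -scalerAl mulrBl bK bKi.
  rewrite -scalerBl scalerA hw_lambdaS scalerDl.
  case: n => [|n]; first by rewrite l0 !scale0r subr0 add0r.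
  by rewrite [X in X - _]addrC addrK.
- by rewrite bL l0 scale0r.
exact: bK.
Qed.

(** * Transfer to the idempotents of [Uq] *)

Lemma map_scale_triple_a0 (A B : algType k) (f : {lrmorphism A -> B}) (E F K : A) :
  forall c, f (c *: triple_a0 E F K) = c *: triple_a0 (f E) (f F) (f K).
Proof.
move=> d.
have fZ c x : f (c *: x) = c *: f x by exact: linearZ.
rewrite fZ /triple_a0 !rmorphM !rmorphXn raddf_sum; congr (_ *: (_ * _)).
by apply: eq_bigr => l _; rewrite [LHS]fZ rmorphXn.
Qed.

Hypothesis e_coef_neq0 : e_coef != 0.

Lemma e_idemE :
  e_idem q p_gt1 s
  = e_coef^-1 *: triple_a0 (Uq_E q p_gt1) (Uq_F q p_gt1) (Uq_K q p_gt1).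
Proof. by []. Qed.

Lemma e_idem_neq0 : e_idem q p_gt1 s != 0.
Proof.
have [A [E [F [K [w [T Ew Kw w0]]]]]] := Uq_triple_module.
have [f [f0 fE fF fK]] := Uq_lift p_gt1 T.
apply: contraNneq w0; rewrite e_idemE.
set pi : {lrmorphism _ -> _} := pres_pi (Uq_proper q p_gt1).
(* The idempotent is lifted to the free algebra, where [f] is defined; if it were 0, its image would
   kill w as well as fix it. *)
have -> : e_coef^-1 *: triple_a0 (Uq_E q p_gt1) (Uq_F q p_gt1) (Uq_K q p_gt1)
    = pi (e_coef^-1 *: triple_a0 (gen_E k) (gen_F k) (gen_K k)).
  exact/esym/(map_scale_triple_a0 pi).
move/f0; rewrite map_scale_triple_a0 fE fF fK => e0.
by rewrite -(triple_e_hw T e_coef_neq0 Ew Kw) e0 mul0r.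
Qed.

Lemma e_idem_idem : e_idem q p_gt1 s * e_idem q p_gt1 s = e_idem q p_gt1 s.
Proof.
have T := Uq_generators_triple q p_gt1.
exact: (triple_e_hw T e_coef_neq0 (triple_e_E T) (triple_e_K T)).
Qed.

(** Each e x e is a multiple of e; conversely c e is a Casimir eigenvector, hence lies in the block
    with exponent 1, and e fixes it on both sides. *)
Lemma corner_QblockP j (y : Uq q p_gt1) :
  casimir_eigenvalue q j = - (s + s) / (q - q^-1) ^+ 2 ->
  corner (e_idem q p_gt1 s) (Qblock q p_gt1 j) y
  <-> exists c, y = c *: e_idem q p_gt1 s.
Proof.
move=> bj; have T := Uq_generators_triple q p_gt1.
have eE := triple_e_E T; have eK := triple_e_K T.
have ee := e_idem_idem.
have eC := triple_casimir T eE eK.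
have eX := triple_e_corner T e_coef_neq0 (@Uq_ind k p q p_gt1).
rewrite -e_idemE in eE eK eC eX.
split=> [[x _ <-]|[c ->]]; first exact: eX.
exists (c *: e_idem q p_gt1 s).
  by exists 1%N; apply: eigenvector_scale; rewrite bj; apply: eC.
exact: (idempotent_scale c ee).
Qed.

End HighestWeightVectors.

(** * Algebras spanned by one idempotent, and powers of the root of unity *)

Lemma line_algebra (k : fieldType) (A : algType k) (e : A) (B : set A) :
  e * e = e -> e != 0 -> (forall y, B y <-> exists c : k, y = c *: e) ->
  [/\ is_unital_algebra e B, has_dimension B 1 & is_commutative B].
Proof.
move=> ee e0 BP.
have Be : B e by apply/BP; exists 1; rewrite scale1r.
split.
- split=> //.
  + move=> c x y /BP[a ->] /BP[b ->]; apply/BP; exists (c * a + b).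
    by rewrite scalerDl scalerA.
  + move=> x y /BP[a ->] /BP[b ->]; apply/BP; exists (a * b).
    by rewrite -scalerAl -scalerAr ee scalerA.
  by move=> x /BP[a ->]; rewrite -scalerAl -scalerAr ee.
- exists (fun=> e); split=> [//|c|x /BP[a ->]].
    rewrite big_ord1 => /eqP; rewrite scaler_eq0 (negPf e0) orbF => /eqP c0 i.
    by rewrite ord1.
  by exists (fun=> a); rewrite big_ord1.
move=> x y /BP[a ->] /BP[b ->].
by rewrite -!scalerAl -!scalerAr !scalerA mulrC.
Qed.

Lemma qroot_exp (R : realType) (p n : nat) :
  qroot R p ^+ n = (cos (n%:R * (pi / p%:R)) +i* sin (n%:R * (pi / p%:R)))%C.
Proof.
elim: n => [|n IH]; first by rewrite expr0 mul0r cos0 sin0.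
rewrite exprS IH /qroot; set t := pi / _.
have -> : n.+1%:R * t = t + n%:R * t by rewrite -natr1; ring.
rewrite cosD sinD.
by apply/eqP; rewrite eq_complex /=; apply/andP; split; apply/eqP; ring.
Qed.

Lemma qroot_exp_p (R : realType) (p : nat) : (0 < p)%N -> qroot R p ^+ p = -1.
Proof.
move=> p0; have pn0 : p%:R != 0 :> R by rewrite pnatr_eq0 -lt0n.
rewrite qroot_exp mulrC divfK // cospi sinpi.
by apply/eqP; rewrite eq_complex /= oppr0 !eqxx.
Qed.

(** The angle n pi / p lies strictly between 0 and pi, so its sine is positive and q^(2n) cannot be
    1. *)
Lemma qroot_exp_neq_inv (R : realType) (p n : nat) : (0 < n < p)%N ->
  qroot R p ^+ n - qroot R p ^- n != 0.
Proof.
move=> /andP[n0 np]; have p0 : (0 < p)%N by apply: leq_trans np.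
have pR : 0 < p%:R :> R by rewrite ltr0n.
have sn : 0 < sin (n%:R * (pi / p%:R)) :> R.
  apply: sin_gt0_pi; rewrite mulr_gt0 ?ltr0n ?divr_gt0 ?pi_gt0 //=.
  by rewrite mulrA ltr_pdivrMr // mulrC ltr_pM2l ?pi_gt0 // ltr_nat.
have q0 : qroot R p ^+ n != 0.
  by rewrite qroot_exp eq_complex /= negb_and (gt_eqF sn) orbT.
rewrite subr_eq0; apply/eqP => h.
have : qroot R p ^+ n * qroot R p ^+ n = 1 by rewrite {1}h mulVf.
rewrite qroot_exp => /eqP; rewrite eq_complex /= => /andP[/eqP + /eqP].
(* The two parts read x^2 - y^2 = 1 and 2 x y = 0, against y > 0. *)
move: sn; set x := cos _; set y := sin _; nra.
Qed.

Theorem proposition4p1 (R : realType) (p : nat) (hp : (2 <= p)%N) :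
  let q : R[i] := qroot R p in
  let e_minus : Uq q hp := e_idem q hp (-1) in
  let e_plus : Uq q hp := e_idem q hp 1 in
  let B_0 := corner e_minus (Qblock q hp 0) in
  let B_p := corner e_plus (Qblock q hp p) in
  [/\ is_unital_algebra e_minus B_0, has_dimension B_0 1 & is_commutative B_0]
  /\
  [/\ is_unital_algebra e_plus B_p, has_dimension B_p 1 & is_commutative B_p].
Proof.
move=> q e_minus e_plus B_0 B_p.
have qp : q ^+ p = -1 by apply: qroot_exp_p; apply: ltnW.
have qn n : (0 < n < p)%N -> q ^+ n - q ^- n != 0 by apply: qroot_exp_neq_inv.
have qq : q - q^-1 != 0 by have := qn 1%N; rewrite expr1; apply.
have ec (s : R[i]) : s * s = 1 -> e_coef p q s != 0.
  move=> ss; have s0 : s != 0.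
    by apply: contra_eq_neq ss => ->; rewrite mulr0 eq_sym oner_eq0.
  rewrite mulf_neq0 //; first by rewrite pnatr_eq0 -lt0n; lia.
  rewrite prodf_seq_neq0; apply/allP => i; rewrite mem_index_iota /= => /andP[i0 ip].
  by rewrite !mulf_neq0 ?invr_eq0 ?qn //; lia.
have n11 : -1 * -1 = 1 :> R[i] by rewrite mulrNN mulr1.
have p11 : 1 * 1 = 1 :> R[i] by rewrite mulr1.
split; apply: line_algebra.
- exact: (e_idem_idem hp qp n11 qq (ec _ n11)).
- exact: (e_idem_neq0 hp qp n11 qq (ec _ n11)).
- move=> y; apply: (corner_QblockP qp n11 qq (ec _ n11)).
  (* For s = -1 the Casimir eigenvalue is 2 / (q - q^(-1))^2, which is beta_0. *)
  by rewrite /casimir_eigenvalue expr0 invr1 opprD !opprK.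
- exact: (e_idem_idem hp qp p11 qq (ec _ p11)).
- exact: (e_idem_neq0 hp qp p11 qq (ec _ p11)).
move=> y; apply: (corner_QblockP qp p11 qq (ec _ p11)).
(* For s = 1 it is the opposite, which is beta_p because q^p = -1. *)
by rewrite /casimir_eigenvalue qp invrN invr1 opprD.
Qed.
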